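(* Let $n\ge 7$. If $G$ and $H$ are graphs on $n$ vertices with the same $(n-3)$-deck, i.e. $\mathcal{D}_{n-3}(G)=\mathcal{D}_{n-3}(H)$, then $G$ and $H$ have the same degree list (multiset of vertex degrees). Moreover, the threshold on $n$ is sharp: there exist two graphs on $6$ vertices with the same $3$-deck but different degree lists.
   Context: All graphs are finite and simple. For a graph $G$, a $k$-card of $G$ is an induced subgraph of $G$ on $k$ vertices, considered up to isomorphism. The $k$-deck $\mathcal{D}_k(G)$ is the multiset of all $k$-cards of $G$ (one for each $k$-element vertex subset). *)

(* Defs.v *)
From mathcomp Require Import all_boot.
Set Implicit Arguments. Unset Strict Implicit. Unset Printing Implicit Defensive.

Definition simple_graph (n : nat) (G : rel 'I_n) : Prop :=
  irreflexive G /\ symmetric G.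

Definition induced_iso (n k : nat) (G : rel 'I_n) (S : {set 'I_n}) (F : rel 'I_k) : bool :=
  [exists f : {ffun 'I_k -> 'I_n},
     [&& injectiveb f, f @: [set: 'I_k] == S &
         [forall i, forall j, F i j == G (f i) (f j)]]].

Definition deck_mult (n k : nat) (G : rel 'I_n) (F : rel 'I_k) : nat :=
  #|[set S : {set 'I_n} | (#|S| == k) && induced_iso G S F]|.

Definition same_deck (n k : nat) (G H : rel 'I_n) : Prop :=
  forall F : rel 'I_k, simple_graph F -> deck_mult G F = deck_mult H F.

Definition degree (n : nat) (G : rel 'I_n) (v : 'I_n) : nat := #|[set u | G v u]|.

Definition same_degree_list (n : nat) (G H : rel 'I_n) : bool :=
  perm_eq [seq degree G v | v <- enum 'I_n] [seq degree H v | v <- enum 'I_n].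

(* Main.v *)
Require Import Defs.
From mathcomp Require Import all_boot all_order all_algebra zify ring lra.
Set Implicit Arguments. Unset Strict Implicit. Unset Printing Implicit Defensive.
Import Order.TTheory GRing.Theory Num.Theory.

(** The [k]-deck determines how many injections ['I_k -> 'I_n] induce each labelled pattern,
    hence (by forgetting vertices) the same for smaller patterns.  Counting stars shows that
    [\sum_v (deg v) ^_ j] is determined for [j <= n - 4], i.e. that
    [D := \sum_v X^(deg_G v) - \sum_v X^(deg_H v)] equals [q * (1 - X) ^+ (n - 3)] with
    [deg q <= 2].  Since [|D(-1)| <= 2 n < 2 ^ (n - 3)], the factor [q] vanishes at [-1], so
    [q = (1 + X) (a + b X)].  The coefficients of [D] have absolute values summing to at most
    [2 n], which forces [a = b = 0] for [n >= 8] and leaves [(a, b) = +-(1, 0), +-(0, 1), +-(1, 1)]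
    for [n = 7].  There [(1, 1)] would give one graph both an isolated and a dominating vertex,
    [(0, 1)] is [(1, 0)] for the complements, and for [(1, 0)] the graph [H] must be [K4] with
    three pendant edges, which contains [K4] but no induced [2 K2], whereas [G] contains [2 K2]
    as soon as it contains [K4].
    For [n = 6], the cycle [C5] plus an isolated vertex and the spider with legs 1, 2, 2 have
    equally many edges and paths of length two, and no triangles. *)

(** * Embeddings *)

(** Keeping the labels turns isomorphism counts into counts of functions, where deleting a vertex is
    just restriction. *)
Definition emb (n k : nat) (G : rel 'I_n) (F : rel 'I_k) : {set {ffun 'I_k -> 'I_n}} :=
  [set f : {ffun 'I_k -> 'I_n} | injectiveb f && [forall i, forall j, F i j == G (f i) (f j)]].

Lemma embP n k (G : rel 'I_n) (F : rel 'I_k) (f : {ffun 'I_k -> 'I_n}) :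
  reflect (injective f /\ forall i j, F i j = G (f i) (f j)) (f \in emb G F).
Proof.
rewrite inE; apply: (iffP andP) => -[/injectiveP injf FG]; split=> //.
- by move=> i j; have /forallP/(_ j)/eqP := forallP FG i.
- by apply/forallP=> i; apply/forallP=> j; apply/eqP.
Qed.

(** Composition with [f0] maps the automorphisms of [F] bijectively onto the embeddings that share
    its image. *)
Lemma card_emb_fiber n k (G : rel 'I_n) (F : rel 'I_k) (f0 : {ffun 'I_k -> 'I_n}) :
  f0 \in emb G F ->
  #|[set f in emb G F | f @: [set: 'I_k] == f0 @: [set: 'I_k]]| = #|emb F F|.
Proof.
move=> /embP[inj0 F0].
pose c (g : {ffun 'I_k -> 'I_k}) := [ffun i => f0 (g i)].
have injc : injective c.
  by move=> g h /ffunP e; apply/ffunP=> i; apply: inj0; have := e i; rewrite !ffunE.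
rewrite -(card_imset _ injc); apply: eq_card => f; rewrite inE.
apply/andP/imsetP => [[/embP[injf Ff] /eqP imf]|[g /embP[injg Fg] ->]]; last first.
  split; first by apply/embP; split=> [i j|i j]; rewrite !ffunE; [move/inj0/injg | rewrite Fg F0].
  rewrite eqEcard !card_imset ?leqnn ?andbT //; last by move=> i j; rewrite !ffunE => /inj0/injg.
  by apply/subsetP=> _ /imsetP[i _ ->]; rewrite ffunE imset_f ?inE.
have ex i : exists j, f0 j == f i.
  have : f i \in f @: [set: 'I_k] by rewrite imset_f ?inE.
  by rewrite imf => /imsetP[j _ ->]; exists j.
pose g := [ffun i => xchoose (ex i)].
have gE i : f0 (g i) = f i by rewrite ffunE; apply/eqP; apply: (xchooseP (ex i)).
exists g; last by apply/ffunP=> i; rewrite ffunE gE.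
apply/embP; split=> [i j e|i j]; last by rewrite [RHS]F0 !gE Ff.
by apply: injf; rewrite -!gE e.
Qed.

Lemma induced_isoP n k (G : rel 'I_n) (S : {set 'I_n}) (F : rel 'I_k) :
  reflect (exists2 f, f \in emb G F & f @: [set: 'I_k] = S) (induced_iso G S F).
Proof.
apply: (iffP existsP) => [[f /and3P[injf /eqP imf FG]]|[f fE imf]]; exists f => //.
  by rewrite inE injf.
by move: fE; rewrite inE => /andP[-> ->]; rewrite imf eqxx.
Qed.

Lemma card_emb_deck n k (G : rel 'I_n) (F : rel 'I_k) :
  #|emb G F| = deck_mult G F * #|emb F F|.
Proof.
rewrite -sum1_card (partition_big (fun f : {ffun 'I_k -> 'I_n} => f @: [set: 'I_k])
  (fun S => (#|S| == k) && induced_iso G S F)) /=; last first.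
  move=> f fE; apply/andP; split; last by apply/induced_isoP; exists f.
  by have /embP[injf _] := fE; rewrite card_imset // cardsT card_ord.
rewrite /deck_mult -sum_nat_const big_mkcond [RHS]big_mkcond /=.
apply: eq_bigr => S _; rewrite inE; case: ifP => // /andP[_ /induced_isoP[f0 f0E <-]].
by rewrite -(card_emb_fiber f0E) -sum1_card; apply: eq_bigl => f; rewrite !inE.
Qed.

Lemma emb_self_gt0 k (F : rel 'I_k) : 0 < #|emb F F|.
Proof.
apply/card_gt0P; exists [ffun i => i].
by apply/embP; split=> i j; rewrite !ffunE.
Qed.

Definition same_emb (n k : nat) (G H : rel 'I_n) := forall F : rel 'I_k, #|emb G F| = #|emb H F|.

(** The deck speaks only of simple [F]; any other [F] has no embedding into a simple graph, so both
    counts are zero. *)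
Lemma same_deck_emb n k (G H : rel 'I_n) :
  simple_graph G -> simple_graph H -> same_deck k G H -> same_emb k G H.
Proof.
move=> sG sH GH F.
have simF (K : rel 'I_n) f : simple_graph K -> f \in emb K F -> simple_graph F.
  by move=> [irr sym] /embP[_ FE]; split=> [i|i j]; rewrite !FE ?irr // sym.
have [eG|[f fE]] := set_0Vmem (emb G F); last first.
  by rewrite (card_emb_deck G) (card_emb_deck H) (GH F) //; apply: simF sG fE.
have [eH|[f fE]] := set_0Vmem (emb H F); first by rewrite eG eH.
by rewrite (card_emb_deck G) (card_emb_deck H) (GH F) //; apply: simF sH fE.
Qed.

Lemma same_emb_deck n k (G H : rel 'I_n) :
  (forall F : rel 'I_k, simple_graph F -> #|emb G F| = #|emb H F|) -> same_deck k G H.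
Proof.
move=> GH F sF; apply/eqP; rewrite -(eqn_pmul2r (emb_self_gt0 F)).
by rewrite -(card_emb_deck G) -(card_emb_deck H) GH.
Qed.

(** A finite function rather than a relation, so that the patterns form a finite type to sum
    over. *)
Definition pattern (n k : nat) (G : rel 'I_n) (f : {ffun 'I_k -> 'I_n}) :
  {ffun 'I_k * 'I_k -> bool} := [ffun p => G (f p.1) (f p.2)].

Lemma patternE n k (G : rel 'I_n) (f : {ffun 'I_k -> 'I_n}) i j :
  pattern G f (i, j) = G (f i) (f j).
Proof. by rewrite ffunE. Qed.

Lemma card_pattern n k (G : rel 'I_n) (P : pred {ffun 'I_k * 'I_k -> bool}) :
  #|[set f : {ffun 'I_k -> 'I_n} | injectiveb f & P (pattern G f)]| =
  \sum_(M | P M) #|emb G (fun i j => M (i, j))|.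
Proof.
rewrite -sum1_card (partition_big (pattern G) P) /=; last by move=> f; rewrite inE => /andP[].
apply: eq_bigr => M PM; rewrite -sum1_card; apply: eq_bigl => f; rewrite !inE -andbA.
case: (injectiveb f) => //=; apply/andP/forallP => [[_ /eqP<-] i|e].
  by apply/forallP=> j; rewrite ffunE.
have -> : pattern G f = M.
  by apply/ffunP=> -[i j]; rewrite ffunE; have /forallP/(_ j)/eqP := e i.
by rewrite PM eqxx.
Qed.

(** Transfers from [G] to [H] every count that depends only on the induced labelled graph:
    extensions of a smaller pattern, stars, copies in the complement. *)
Lemma same_emb_pattern n k (G H : rel 'I_n) (P : pred {ffun 'I_k * 'I_k -> bool}) :
  same_emb k G H ->
  #|[set f : {ffun 'I_k -> 'I_n} | injectiveb f & P (pattern G f)]| =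
  #|[set f : {ffun 'I_k -> 'I_n} | injectiveb f & P (pattern H f)]|.
Proof. by move=> GH; rewrite !card_pattern; apply: eq_bigr => M _; rewrite GH. Qed.

(** * Forgetting vertices and counting stars *)

Definition fcons (T : finType) k (x : T) (g : {ffun 'I_k -> T}) : {ffun 'I_k.+1 -> T} :=
  [ffun i => if unlift ord0 i is Some j then g j else x].

Lemma fcons0 (T : finType) k (x : T) (g : {ffun 'I_k -> T}) : fcons x g ord0 = x.
Proof. by rewrite ffunE unlift_none. Qed.

Lemma fcons_lift (T : finType) k (x : T) (g : {ffun 'I_k -> T}) i :
  fcons x g (lift ord0 i) = g i.
Proof. by rewrite ffunE liftK. Qed.

Lemma fcons_injective (T : finType) k (x : T) (g : {ffun 'I_k -> T}) :
  injectiveb (fcons x g) = (x \notin codom g) && injectiveb g.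
Proof.
apply/injectiveP/andP => [inj|[xg /injectiveP injg]].
  split; last first.
    apply/injectiveP=> i j e.
    by apply: (@lift_inj _ ord0); apply: inj; rewrite !fcons_lift.
  apply/codomP=> -[i e]; have := @inj ord0 (lift ord0 i).
  by rewrite fcons0 fcons_lift => /(_ e).
move=> i j; case: (unliftP ord0 i) => [i'|] ->; case: (unliftP ord0 j) => [j'|] -> //;
  rewrite ?fcons0 ?fcons_lift.
- by move/injg->.
- by move=> e; rewrite -e codom_f in xg.
- by move=> e; rewrite e codom_f in xg.
Qed.

Lemma card_fcons (T : finType) k (P : pred {ffun 'I_k.+1 -> T}) :
  #|[set f : {ffun 'I_k.+1 -> T} | injectiveb f & P f]| =
  #|[set p : T * {ffun 'I_k -> T} |
      [&& p.1 \notin codom p.2, injectiveb p.2 & P (fcons p.1 p.2)]]|.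
Proof.
pose c (p : T * {ffun 'I_k -> T}) := fcons p.1 p.2.
have injc : injective c.
  move=> [x g] [y h] /ffunP e; congr (_, _); first by have := e ord0; rewrite !fcons0.
  by apply/ffunP=> i; have := e (lift ord0 i); rewrite !fcons_lift.
rewrite -[RHS](card_imset _ injc); apply: eq_card => f.
apply/idP/imsetP => [|[[x g]]]; last first.
  by rewrite !inE /= andbA -fcons_injective => fP ->.
have -> : f = c (f ord0, [ffun i => f (lift ord0 i)]).
  apply/ffunP=> i; rewrite /c /=.
  by case: (unliftP ord0 i) => [i'|] ->; rewrite ?fcons0 ?fcons_lift ?ffunE.
by rewrite inE fcons_injective -andbA => fP; eexists; last reflexivity; rewrite inE.
Qed.

(** Each embedding of [F] extends by a fresh image of [ord0] in exactly [n - k] ways, a positive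
    factor that cancels. *)
Lemma same_emb_pred n k (G H : rel 'I_n) : k < n -> same_emb k.+1 G H -> same_emb k G H.
Proof.
move=> ltkn GH F.
pose P (M : {ffun 'I_k.+1 * 'I_k.+1 -> bool}) :=
  [forall i, forall j, F i j == M (lift ord0 i, lift ord0 j)].
suff emb_ext (K : rel 'I_n) :
    #|[set f : {ffun 'I_k.+1 -> 'I_n} | injectiveb f & P (pattern K f)]| = #|emb K F| * (n - k).
  by apply/eqP; rewrite -(@eqn_pmul2r (n - k)) ?subn_gt0 // -!emb_ext; apply/eqP/same_emb_pattern.
rewrite card_fcons -sum1_card.
rewrite (partition_big snd (mem (emb K F))) /=; last first.
  move=> [x g]; rewrite !inE /= => /and3P[_ -> /forallP e]; apply/forallP=> i.
  apply/forallP=> j; have /forallP/(_ j) := e i; rewrite ffunE /= !fcons_lift; exact.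
rewrite -sum_nat_const; apply: eq_bigr => g gE.
have /embP[injg FG] := gE.
transitivity #|~: [set x in codom g]|; last first.
  rewrite cardsCs setCK card_ord cardsE; congr (_ - _).
  by rewrite card_codom // card_ord.
rewrite -sum1_card (reindex (fun x => (x, g))) /=; last first.
  by exists fst => [x|[x h]] //=; rewrite !inE /= => /andP[_ /eqP->].
apply: eq_bigl => x; rewrite !inE /= eqxx andbT.
have -> : injectiveb g by apply/injectiveP.
have -> : P (pattern K (fcons x g)); last by rewrite /= andbT.
by apply/forallP=> i; apply/forallP=> j; rewrite ffunE /= !fcons_lift FG.
Qed.

Lemma same_emb_le n k m (G H : rel 'I_n) : m <= k <= n -> same_emb k G H -> same_emb m G H.
Proof.
elim: k => [|k IH] /andP[]; first by rewrite leqn0 => /eqP->.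
rewrite leq_eqVlt => /predU1P[->//|lemk] ltkn GH.
by apply: IH; [rewrite -ltnS lemk ltnW | apply: same_emb_pred].
Qed.

(** Once the centre is fixed, the leaves form an injection into its neighbourhood, with no condition
    among themselves; irreflexivity keeps the centre out of that neighbourhood. *)
Lemma card_star n j (G : rel 'I_n) : irreflexive G ->
  #|[set f : {ffun 'I_j.+1 -> 'I_n} | injectiveb f &
       [forall i, pattern G f (ord0, lift ord0 i)]]| = \sum_v degree G v ^_ j.
Proof.
move=> irr.
rewrite (card_fcons (fun f : {ffun 'I_j.+1 -> 'I_n} => [forall i, pattern G f (ord0, lift ord0 i)])).
rewrite -sum1_card (partition_big fst predT) //=.
apply: eq_bigr => v _.
have := @card_inj_ffuns_on 'I_j 'I_n (pred_of_set [set u | G v u]).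
rewrite card_ord -/(degree G v) => <-; rewrite -sum1_card.
rewrite (reindex (fun g => (v, g))) /=; last first.
  by exists snd => [g|[x h]] //=; rewrite !inE /= => /andP[_ /eqP->].
apply: eq_bigl => g; rewrite !in_set /= eqxx andbT.
have -> : [forall i, pattern G (fcons v g) (ord0, lift ord0 i)] = (g \in ffun_on [set u | G v u]).
  by apply/forallP/ffun_onP => e i; have := e i; rewrite patternE fcons0 fcons_lift inE.
case gV : (g \in ffun_on _); last by rewrite !andbF.
suff -> : v \notin codom g by rewrite ?andbT /=.
by apply/codomP=> -[i e]; have /ffun_onP/(_ i) := gV; rewrite inE -e irr.
Qed.

Lemma same_star n k j (G H : rel 'I_n) : irreflexive G -> irreflexive H ->
  j < k <= n -> same_emb k G H -> \sum_v degree G v ^_ j = \sum_v degree H v ^_ j.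
Proof.
move=> iG iH jkn /(same_emb_le jkn) GH; rewrite -!card_star //.
exact: (same_emb_pattern (fun M => [forall i, M (ord0, lift ord0 i)])).
Qed.

(** * The degree polynomial *)

Local Open Scope ring_scope.

Definition degpoly (n : nat) (G : rel 'I_n) : {poly int} := \sum_v 'X^(degree G v).

Definition degree_count (n : nat) (G : rel 'I_n) (i : nat) : nat :=
  #|[set v | degree G v == i]|.

Lemma coef_degpoly n (G : rel 'I_n) i :
  (degpoly G)`_i = (degree_count G i)%:R.
Proof.
rewrite coef_sum (eq_bigr (fun v => if degree G v == i then 1 else 0)); last first.
  by move=> v _; rewrite coefXn eq_sym; case: ifP.
by rewrite -big_mkcond /= sumr_const; congr (_ *+ _); apply: eq_card => v; rewrite inE.
Qed.

Lemma degpoly_inj n (G H : rel 'I_n) : degpoly G = degpoly H -> same_degree_list G H.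
Proof.
move=> e; apply/allP=> i _; rewrite /=.
have countE (K : rel 'I_n) :
    count_mem i [seq degree K v | v <- enum 'I_n] = degree_count K i.
  by rewrite count_map /degree_count cardsE cardE size_filter enumT; apply: eq_count.
rewrite !countE; apply/eqP; have /(congr1 (fun p : {poly int} => p`_i)) := e.
by rewrite !coef_degpoly => /eqP; rewrite eqr_nat => /eqP.
Qed.

Lemma degree_lt n (G : rel 'I_n) v : irreflexive G -> (degree G v < n)%N.
Proof.
move=> irr; rewrite -{2}(card_ord n) -cardsT; apply: proper_card.
by apply/properP; split; [exact: subsetT | exists v; rewrite ?inE ?irr].
Qed.

Lemma coef_degpoly_ge n (G : rel 'I_n) i : irreflexive G -> (n <= i)%N -> (degpoly G)`_i = 0.
Proof.
move=> irr leni; rewrite coef_degpoly; apply/eqP; rewrite pnatr_eq0 cards_eq0.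
apply/eqP/setP=> v; rewrite !inE; apply: contraTF leni => /eqP<-.
by rewrite -ltnNge degree_lt.
Qed.

Lemma sum_coef_degpoly n (G : rel 'I_n) : irreflexive G ->
  \sum_(i < n) (degpoly G)`_i = n%:R.
Proof.
move=> irr; transitivity (#|'I_n|%:R : int); last by rewrite card_ord.
rewrite -sum1_card.
rewrite [X in _ = X%:R](partition_big (fun v => Ordinal (degree_lt v irr)) predT) //= natr_sum.
apply: eq_bigr => i _; rewrite coef_degpoly /degree_count -sum1_card; congr (_%:R).
by apply: eq_bigl => v; rewrite inE.
Qed.

(** The coefficient of [X^j] in [(1 + X)^d] is ['C(d, j)], so the Taylor coefficients at 1 are the
    factorial moments of the degrees, up to [j!]. *)
Lemma coef_degpoly_shift n (G : rel 'I_n) j :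
  (degpoly G \Po ('X + 1))`_j * j`!%:R = (\sum_v degree G v ^_ j)%N%:R.
Proof.
rewrite /degpoly raddf_sum /= coef_sum mulr_suml natr_sum; apply: eq_bigr => v _.
rewrite comp_Xn_poly exprDn coef_sum -bin_ffact natrM; congr (_ * _).
rewrite (eq_bigr (fun i : 'I__ => ('C(degree G v, i) * (j == degree G v - i))%N%:R)); last first.
  by move=> i _; rewrite expr1n mulr1 coefMn coefXn -mulrnA mulnC.
have [ltj|lej] := ltnP (degree G v) j.
  rewrite bin_small // big1 // => i _; rewrite -[j == _]negbK.
  by rewrite (_ : j != _) ?muln0 //; lia.
have ltj : (degree G v - j < (degree G v).+1)%N by lia.
rewrite (bigD1 (Ordinal ltj)) //= big1 => [|i].
  by rewrite addr0 subKn // eqxx muln1 bin_sub.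
rewrite -val_eqE /= => ne; have := ltn_ord i.
case: eqP; rewrite ?muln0 // => *; lia.
Qed.

(** Equal factorial moments make the first [m] Taylor coefficients of the difference at 1 vanish. *)
Lemma degpoly_factor n m (G H : rel 'I_n) :
  (forall j, (j < m)%N -> (\sum_v degree G v ^_ j = \sum_v degree H v ^_ j)%N) ->
  exists q : {poly int}, degpoly G - degpoly H = q * (1 - 'X) ^+ m.
Proof.
move=> GH; set D := _ - _.
have low j : (j < m)%N -> (D \Po ('X + 1))`_j = 0.
  move=> ltj; apply/eqP; rewrite /D comp_polyB coefB subr_eq0.
  have fj : (j`!%:R : int) != 0 by rewrite pnatr_eq0 -lt0n fact_gt0.
  by apply/eqP; apply: (mulIf fj); rewrite !coef_degpoly_shift GH.
pose E := D \Po ('X + 1); pose Q := drop_poly m E.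
have EQ : E = Q * 'X^m.
  rewrite -[LHS](poly_take_drop m) (_ : take_poly m E = 0) ?add0r //.
  by apply/polyP=> i; rewrite coef_take_poly coef0; case: ifP => // /low.
have DE : D = E \Po ('X - 1) by rewrite /E -polyC1 comp_polyXaddC_K.
(* The sign converts the power of [X - 1] into one of [1 - X]. *)
exists ((-1) ^+ m *: (Q \Po ('X - 1))).
rewrite DE EQ comp_polyM comp_Xn_poly -[1 - 'X]opprB -scalerAl (exprNn ('X - 1)) mulrCA.
by rewrite -mul_polyC rmorphXn /= rmorphN1 !mulrA -exprMn mulrNN mulr1 expr1n mul1r.
Qed.

(** * Coefficients of multiples of [(1 - X) ^+ m] *)

Definition altbin (m i : nat) : int := (-1) ^+ i * 'C(m, i)%:R.

Lemma coef_1subX_exp m i : ((1 - 'X) ^+ m : {poly int})`_i = altbin m i.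
Proof.
rewrite /altbin.
elim: m i => [|m IH] i; first by rewrite expr0 coef1; case: i => [|i] /=; rewrite ?mulr1 ?mulr0.
rewrite exprS mulrBl mul1r coefB coefXM IH; case: i => [|i]; first by rewrite subr0 !bin0.
by rewrite /= IH binS natrD exprS; ring.
Qed.

Lemma size_mul_1subX_exp (q : {poly int}) m :
  q != 0 -> size (q * (1 - 'X) ^+ m) = (size q + m)%N.
Proof.
move=> q0; have s1 : size (1 - 'X : {poly int}) = 2%N by rewrite -opprB size_polyN size_XsubC.
have n1 : (1 - 'X : {poly int}) != 0 by rewrite -size_poly_eq0 s1.
rewrite size_mul ?expf_neq0 //.
have -> : size ((1 - 'X : {poly int}) ^+ m) = m.+1; last by rewrite addnS.
elim: m => [|m IH]; first by rewrite size_poly1.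
by rewrite exprS size_mul ?expf_neq0 // IH s1.
Qed.

Lemma coef_mul_quadratic (q p : {poly int}) i : (size q <= 3)%N ->
  (q * p)`_i = q`_0 * p`_i + (if i is i'.+1 then q`_1 * p`_i' else 0)
     + (if i is i'.+2 then q`_2 * p`_i' else 0).
Proof.
move=> sq.
have qE : q = (q`_0)%:P + (q`_1)%:P * 'X + (q`_2)%:P * 'X^2.
  apply/polyP=> j; rewrite !coefD coefC !coefCM coefX coefXn.
  case: j => [|[|[|j]]] /=; rewrite ?mulr0 ?mulr1 ?add0r ?addr0 //.
  by rewrite nth_default //; apply: leq_trans sq _.
rewrite {1}qE !mulrDl !coefD -!mulrA !coefCM !coefXM.
by case: i => [|[|i]] /=; rewrite ?mulr0.
Qed.

Lemma degpoly_at_m1 n (G : rel 'I_n) : `|(degpoly G).[-1]| <= n%:R.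
Proof.
rewrite /degpoly horner_sum; apply: le_trans (ler_norm_sum _ _ _) _.
rewrite (eq_bigr (fun=> 1)) ?sumr_const ?card_ord // => v _.
by rewrite hornerXn normrX normrN1 expr1n.
Qed.

(** The base case is [14 < 16]; the inequality fails at [n = 6]. *)
Lemma exp2_gt n : (7 <= n)%N -> (2 * n < 2 ^ (n - 3))%N.
Proof.
elim: n => // n IH; rewrite leq_eqVlt => /predU1P[<-//|]; rewrite ltnS => n7.
by rewrite subSn ?expnS; [have := IH n7 | ]; lia.
Qed.

(** Both polynomials have nonnegative coefficients with sum [n]. *)
Lemma l1_degpoly n (G H : rel 'I_n) : irreflexive G -> irreflexive H ->
  \sum_(i < n) `|(degpoly G - degpoly H)`_i| <= (2 * n)%:R.
Proof.
move=> iG iH; rewrite mul2n -addnn natrD -{1}(sum_coef_degpoly iG) -{1}(sum_coef_degpoly iH).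
rewrite -big_split /=; apply: ler_sum => i _; rewrite coefB.
apply: le_trans (ler_normB _ _) _.
by rewrite !ger0_norm // coef_degpoly ler0n.
Qed.

(* The coefficients of [(1 + X) (a + b X) (1 - X) ^+ m]. *)
Definition altpoly (a b : int) (m i : nat) : int :=
  a * altbin m i + (if i is i'.+1 then (a + b) * altbin m i' else 0)
   + (if i is i'.+2 then b * altbin m i' else 0).

Lemma degpoly_diff n (G H : rel 'I_n) : (7 <= n)%N -> irreflexive G -> irreflexive H ->
  same_emb (n - 3) G H ->
  exists a b : int, forall i, (degpoly G - degpoly H)`_i = altpoly a b (n - 3) i.
Proof.
move=> n7 iG iH GH.
have [q qE] : exists q : {poly int}, degpoly G - degpoly H = q * (1 - 'X) ^+ (n - 3).
  (* A star with [j] leaves has [j + 1] vertices, so every [j < n - 3] is available. *)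
  by apply: degpoly_factor => j ltj; apply: (@same_star _ (n - 3)) => //; lia.
have sq : (size q <= 3)%N.
  have [->|q0] := eqVneq q 0; first by rewrite size_poly0.
  have := size_mul_1subX_exp (n - 3) q0; rewrite -qE => sE.
  suff : (size (degpoly G - degpoly H)%R <= n)%N by lia.
  by apply/leq_sizeP => j nj; rewrite coefB !coef_degpoly_ge ?subrr.
(* Evaluation at -1 gives [|q(-1)| * 2 ^ (n - 3) <= 2 n < 2 ^ (n - 3)], and [q(-1)] is an
   integer. *)
have q1 : q.[-1] = 0.
  have := congr1 (fun p : {poly int} => p.[-1]) qE.
  rewrite hornerD hornerN hornerM horner_exp.
  have -> : (1 - 'X : {poly int}).[-1] = 2 by rewrite !hornerE.
  have := degpoly_at_m1 G; have := degpoly_at_m1 H; have := exp2_gt n7.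
  rewrite -(ltr_nat int) natrX natrM.
  set N := _ ^+ (n - 3) => h1 h2 h3 h4.
  have : `|q.[-1]| * N < N.
    rewrite -[X in _ * X]ger0_norm -?normrM -?h4; last by rewrite /N exprn_ge0.
    by apply: le_lt_trans h1; apply: le_trans (ler_normB _ _) _; rewrite mulr_natl mulr2n lerD.
  have N0 : 0 < N by rewrite /N exprn_gt0.
  by rewrite -[X in _ < X]mul1r ltr_pM2r // => ?; lia.
(* In [(1 + X) (a + b X)] the outer coefficients are [a] and [b]; the middle one is their sum
   because [q(-1) = 0]. *)
exists q`_0, q`_2 => i; rewrite /altpoly qE coef_mul_quadratic //= !coef_1subX_exp.
have -> : q`_0 + q`_2 = q`_1.
  move: q1; rewrite (horner_coef_wide _ sq) !big_ord_recl big_ord0 /= /bump /=.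
  by rewrite addn0 expr0 expr1 sqrrN expr1n add1n => ?; lia.
by case: i => [|[|i]] /=; rewrite ?coef_1subX_exp.
Qed.

(** * Integer pairs [(a, b)] compatible with the bound [2 n] *)

Ltac expand_altpoly m :=
  rewrite !big_ord_recl big_ord0 /= /bump /= !add1n /altpoly;
  (* With each [altbin] evaluated, the sum consists of absolute values of explicit linear forms in
     [a] and [b]. *)
  repeat match goal with |- context [altbin m ?i] =>
    let v := eval vm_compute in (altbin m i) in
    rewrite (_ : altbin m i = v); last by [] end.

(** The pairs [(1, 0)], [(0, 1)] and [(1, 1)] each give the sum 12, within the bound 14, whereas
    [(1, -1)] gives 20. *)
Lemma altpoly7 (a b : int) : \sum_(i < 7) `|altpoly a b 4 i| <= 14%:R ->
  [\/ a = 0 /\ b = 0, `|a| = 1 /\ b = 0, a = 0 /\ `|b| = 1 | `|a| = 1 /\ b = a].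
Proof.
expand_altpoly 4%N => le14.
have [ha hb] : `|a| <= 1 /\ `|b| <= 1 by lia.
suff : (a == 0) && (b == 0) || (`|a| == 1) && (b == 0) || (a == 0) && (`|b| == 1)
       || (`|a| == 1) && (b == a).
  by case/orP=> [/orP[/orP[]|]|] /andP[/eqP ? /eqP ?];
    [apply: Or41 | apply: Or42 | apply: Or43 | apply: Or44].
lia.
Qed.

(** These values of [m] are settled numerically, since the inequality [4 m <= 'C(m, 2)] behind the
    general estimate starts at [m = 9]. *)
Lemma altpoly8_11 (a b : int) m : (5 <= m <= 8)%N ->
  \sum_(i < m.+3) `|altpoly a b m i| <= (2 * m.+3)%:R -> a = 0 /\ b = 0.
Proof.
move=> /andP[m5 m8].
have : m \in [:: 5; 6; 7; 8]%N by rewrite !inE; lia.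
rewrite !inE => /or4P[] /eqP->.
- by expand_altpoly 5%N; lia.
- by expand_altpoly 6%N; lia.
- by expand_altpoly 7%N; lia.
- by expand_altpoly 8%N; lia.
Qed.

(** The three lowest and three highest coefficients alone exceed the bound unless [a = b = 0]; those
    with ['C(m, 2)] dominate. *)
Lemma altpoly_ge12 (a b : int) m : (9 <= m)%N ->
  \sum_(i < m.+3) `|altpoly a b m i| <= (2 * m.+3)%:R -> a = 0 /\ b = 0.
Proof.
case: m => [|[|[|k]]] // k9; rewrite -(big_mkord xpredT (fun i => `|altpoly a b k.+3 i|)).
do 3 (rewrite big_nat_recl //); do 3 (rewrite big_nat_recr //=).
have : 0 <= \sum_(0 <= i < k) `|altpoly a b k.+3 i.+3| by apply: sumr_ge0.
set S := \sum_(0 <= i < k) _ => S0.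
have s_norm (x : int) j : `|(-1) ^+ j * x| = `|x| by rewrite normrM normrX normrN1 expr1n mul1r.
pose c : int := 'C(k.+3, 2)%:R; pose M : int := k.+3%:R.
have c4 : 4%:R * M <= c.
  rewrite -natrM ler_nat bin2 -divn2 leq_divRL // -mulnA mulnC -mulnA leq_mul2l /=; lia.
have M9 : 9%:R <= M by rewrite ler_nat.
have bin_k1 : 'C(k.+3, k.+1) = 'C(k.+3, 2) by rewrite -(@bin_sub k.+3 2) // !subSS subn0.
have d0 : altpoly a b k.+3 0 = a by rewrite /altpoly /altbin bin0; ring.
have d1 : altpoly a b k.+3 1 = (a + b) - a * M by rewrite /altpoly /altbin bin0 bin1 /M; ring.
have d2 : altpoly a b k.+3 2 = a * (c - M) - b * (M - 1).
  by rewrite /altpoly /altbin bin0 bin1 -/c -/M; ring.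
have d3 : `|altpoly a b k.+3 k.+3| = `|b * (c - M) - a * (M - 1)|.
  rewrite -[RHS](s_norm _ k.+1) /altpoly /altbin binn binSn bin_k1 -/c -/M.
  by congr `|_|; rewrite (exprS _ k.+2) (exprS _ k.+1); ring.
have d4 : `|altpoly a b k.+3 k.+4| = `|(a + b) - b * M|.
  rewrite -[RHS](s_norm _ k.+3) /altpoly /altbin binn binSn bin_small // -/M.
  by congr `|_|; rewrite (exprS _ k.+2); ring.
have d5 : `|altpoly a b k.+3 k.+4.+1| = `|b|.
  rewrite -[RHS](s_norm _ k.+3) /altpoly /altbin binn !bin_small //.
  by congr `|_|; ring.
rewrite d0 d1 d2 d3 d4 d5 => le_l1.
have tri (x y u v : int) : 0 <= u -> 0 <= v -> `|x| * u - `|y| * v <= `|x * u - y * v|.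
  move=> u0 v0; apply: le_trans (lerB_dist _ _).
  by rewrite !normrM (ger0_norm u0) (ger0_norm v0).
have e1 : `|a + b - a * M| = `|a * (M - 1) - b * 1| by rewrite -normrN; congr `|_|; ring.
have e4 : `|a + b - b * M| = `|b * (M - 1) - a * 1| by rewrite -normrN; congr `|_|; ring.
have M1 : 0 <= M - 1 by lia.
have cM : 0 <= c - M by lia.
have t1 := tri a b _ _ M1 ler01; have t4 := tri b a _ _ M1 ler01.
have t2 := tri a b _ _ cM M1; have t3 := tri b a _ _ cM M1.
(* On adding the four triangle inequalities and the end terms [|a|] and [|b|], the contributions
   with [M - 1] cancel. *)
have main : (`|a| + `|b|) * (c - M) <= 2%:R * M + 6%:R.
  rewrite e1 e4 in le_l1; rewrite (_ : (2 * k.+3.+3)%:R = 2%:R * M + 6%:R) in le_l1; last by rewrite /M; lia.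
  move: t1 t2 t3 t4 le_l1; rewrite !mulr1.
  set A := `|a|; set B := `|b|.
  do 4 (let x := fresh "x" in set x := `|_ - _|).
  lra.
(* In the second case [3 M <= c - M <= 2 M + 6], against [9 <= M]. *)
have [h|h] : `|a| + `|b| <= 0 \/ 1 <= `|a| + `|b| by lia.
  by move: h; clear; lia.
have := ler_wpM2r cM h; rewrite mul1r; lra.
Qed.

Local Close Scope ring_scope.

(** * Seven vertices *)

Definition compl (n : nat) (G : rel 'I_n) : rel 'I_n := fun u v => (u != v) && ~~ G u v.

Lemma compl_simple n (G : rel 'I_n) : simple_graph G -> simple_graph (compl G).
Proof. by move=> [_ sym]; split=> [u|u v]; rewrite /compl ?eqxx // eq_sym sym. Qed.

Lemma degree_compl n (G : rel 'I_n) v : irreflexive G -> degree (compl G) v = n.-1 - degree G v.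
Proof.
move=> irr; have := cardsC [set u | G v u]; rewrite card_ord -/(degree G v) => e.
rewrite (cardsD1 v (~: _)) !inE irr /= add1n in e.
have -> : degree (compl G) v = #|(~: [set u | G v u]) :\ v|.
  by apply: eq_card => u; rewrite !inE eq_sym.
by rewrite -[X in X.-1]e addnS /= addKn.
Qed.

(** Inducing [F] in the complement is a condition on the pattern in the graph itself; injectivity
    turns [f i != f j] into [i != j]. *)
Lemma same_emb_compl n k (G H : rel 'I_n) : same_emb k G H -> same_emb k (compl G) (compl H).
Proof.
move=> GH F.
pose P (M : {ffun 'I_k * 'I_k -> bool}) :=
  [forall i, forall j, F i j == (i != j) && ~~ M (i, j)].
suff embE (K : rel 'I_n) : emb (compl K) F =
    [set f : {ffun 'I_k -> 'I_n} | injectiveb f & P (pattern K f)].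
  by rewrite !embE; apply: same_emb_pattern.
apply/setP=> f; rewrite !inE; case: injectiveP => //= injf.
by apply: eq_forallb => i; apply: eq_forallb => j; rewrite patternE /compl (inj_eq injf).
Qed.

Definition K4 : rel 'I_4 := fun i j => i != j.
(** Halving pairs 0 with 1 and 2 with 3. *)
Definition twoK2 : rel 'I_4 := fun i j => (i != j) && (i./2 == j./2).

Lemma same_emb_ex n k (G H : rel 'I_n) (F : rel 'I_k) : same_emb k G H ->
  (exists f, f \in emb G F) -> exists f, f \in emb H F.
Proof. by move=> GH /card_gt0P; rewrite GH => /card_gt0P. Qed.

Lemma subseq_card (T : finType) (A : {set T}) k : k <= #|A| ->
  exists s : seq T, [/\ uniq s, size s = k & {subset s <= A}].
Proof.
move=> lek; exists (take k (enum A)); split.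
- by rewrite take_uniq ?enum_uniq.
- by rewrite size_takel // -cardE.
- by move=> x /mem_take; rewrite mem_enum.
Qed.

(* The variables are the adjacencies among three vertices a, b, c of degree 4, three vertices
   x, y, z of degree 1 and a last vertex w.  Adding the first three equations gives
   12 = 2 * 3 + 3 + 3 as an upper bound that must be attained termwise. *)
Lemma pendant_arith (ab ac bc aw bw cw ax ay az bx bb bz cx cy cz xy xz yz xw yw zw : nat) :
  [/\ ab <= 1, ac <= 1, bc <= 1 & aw <= 1] -> bw <= 1 -> cw <= 1 ->
  4 = aw + (0 + (ab + (ac + (ax + (ay + (az + 0)))))) ->
  4 = bw + (ab + (0 + (bc + (bx + (bb + (bz + 0)))))) ->
  4 = cw + (ac + (bc + (0 + (cx + (cy + (cz + 0)))))) ->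
  1 = xw + (ax + (bx + (cx + (0 + (xy + (xz + 0)))))) ->
  1 = yw + (ay + (bb + (cy + (xy + (0 + (yz + 0)))))) ->
  1 = zw + (az + (bz + (cz + (xz + (yz + (0 + 0)))))) ->
  [/\ [/\ ab = 1, ac = 1, bc = 1 & aw = 1], bw = 1, cw = 1
    & [/\ xy = 0, xz = 0, yz = 0 & xw = 0] /\ yw = 0 /\ zw = 0].
Proof. by move=> [? ? ? ?] *; repeat split; lia. Qed.

(** Equality in the degree count makes [a], [b], [c], [w] a clique and spends the only edge of each
    leaf on the triangle [a b c], so no edge avoids that triangle. *)
Lemma K4_pendants (H : rel 'I_7) : simple_graph H ->
  3 <= #|[set v | degree H v == 1]| -> 3 <= #|[set v | degree H v == 4]| ->
  exists a b c w, [/\ [/\ H a b, H a c, H b c, H a w & H b w], H c w, degree H w = 3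
    & forall u v, H u v -> (u \in [:: a; b; c]) || (v \in [:: a; b; c])].
Proof.
move=> [irr sym] /subseq_card[L [uL sL L1]] /subseq_card[A [uA sA A4]].
case: A uA sA A4 => [|a [|b [|c []]]] //= uA _ A4.
case: L uL sL L1 => [|x [|y [|z []]]] //= uL _ L1.
have deg1 v : v \in [:: x; y; z] -> degree H v = 1 by move/L1; rewrite inE => /eqP.
have deg4 v : v \in [:: a; b; c] -> degree H v = 4 by move/A4; rewrite inE => /eqP.
have uAL : uniq ([:: a; b; c] ++ [:: x; y; z]).
  rewrite cat_uniq; apply/and3P; split=> //; apply/hasPn=> v vL; apply/negP=> vA.
  by have := deg1 v vL; rewrite (deg4 v vA).
have [w wN] : exists w, w \notin [:: a; b; c] ++ [:: x; y; z].
  apply/existsP; rewrite -negb_forall; apply/negP=> /forallP all_in.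
  have := card_ord 7; rewrite -cardsT => c7.
  have : #|[set: 'I_7]| <= size ([:: a; b; c] ++ [:: x; y; z]).
    by rewrite -(card_uniqP uAL); apply/subset_leq_card/subsetP=> v _; exact: all_in.
  by rewrite c7.
(* This order makes the expanded degree sums match the equations of [pendant_arith]. *)
pose s := [:: w, a, b, c, x, y & [:: z]].
have us : uniq s by rewrite -[s]/(w :: ([:: a; b; c] ++ [:: x; y; z])) cons_uniq wN.
have s_all : s =i enum 'I_7.
  have [|||_ //] := @uniq_min_size _ s (enum 'I_7) => //; last by rewrite size_enum_ord.
  by move=> v _; rewrite mem_enum.
have degE v : degree H v = \sum_(u <- s) H v u.
  rewrite (perm_big _ (uniq_perm us (enum_uniq _) s_all)) /= big_enum /=.
  by rewrite /degree -sum1_card big_mkcond; apply: eq_bigr => u _; rewrite inE; case: (H v u).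
move: (degE a) (degE b) (degE c) (degE x) (degE y) (degE z) (degE w).
have [da db dc] : [/\ degree H a = 4, degree H b = 4 & degree H c = 4].
  by split; apply: deg4; rewrite !inE eqxx ?orbT.
have [dx dy dz] : [/\ degree H x = 1, degree H y = 1 & degree H z = 1].
  by split; apply: deg1; rewrite !inE eqxx ?orbT.
rewrite da db dc dx dy dz /s !big_cons !big_nil !irr.
(* Each unordered pair is oriented one way, so that the equations share their variables. *)
rewrite !(sym b a) !(sym c a) !(sym c b) !(sym w a) !(sym w b) !(sym w c).
rewrite !(sym x a) !(sym x b) !(sym x c) !(sym y a) !(sym y b) !(sym y c).
rewrite !(sym z a) !(sym z b) !(sym z c) !(sym w x) !(sym w y) !(sym w z).
rewrite !(sym y x) !(sym z x) !(sym z y) => ea eb ec ex ey ez ew.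
have b1 (e : bool) : e = 1 :> nat -> e by case: e.
have b0 (e : bool) : e = 0 :> nat -> e = false by case: e.
have [] := pendant_arith _ _ _ ea eb ec ex ey ez; try by rewrite ?leq_b1.
move=> [/b1 Hab /b1 Hac /b1 Hbc /b1 Haw] /b1 Hbw /b1 Hcw.
move=> [[/b0 exy /b0 exz /b0 eyz /b0 exw] [/b0 eyw /b0 e4]].
exists a, b, c, w; split=> //; first by move: ew; rewrite Haw Hbw Hcw exw eyw e4.
move=> u v.
have := s_all u; have := s_all v; rewrite !mem_enum !inE.
by do 6?case/orP; move/eqP->; do 6?case/orP; move/eqP->; rewrite ?eqxx ?orbT //
 ?irr ?exy ?exz ?eyz ?exw ?eyw ?e4 // sym ?exy ?exz ?eyz ?exw ?eyw ?e4.
Qed.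

(** * Induced [K4] and [2 K2] *)

Definition four (T : finType) (x y z t : T) : {ffun 'I_4 -> T} :=
  [ffun i => tnth [tuple x; y; z; t] i].

Lemma ord4P (P : 'I_4 -> Prop) :
  P (inord 0) -> P (inord 1) -> P (inord 2) -> P (inord 3) -> forall i, P i.
Proof.
move=> P0 P1 P2 P3 i; rewrite -(inord_val i).
by case: i => -[|[|[|[|m]]]].
Qed.

Lemma four_injective (T : finType) (x y z t : T) :
  uniq [:: x; y; z; t] -> injective (four x y z t).
Proof.
move=> u i j; rewrite !ffunE !(tnth_nth x) => /eqP.
by rewrite nth_uniq ?size_tuple // => /eqP/val_inj.
Qed.

Lemma emb_four n (G : rel 'I_n) (F : rel 'I_4) x y z t :
  simple_graph G -> simple_graph F -> uniq [:: x; y; z; t] ->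
  F (inord 0) (inord 1) = G x y -> F (inord 0) (inord 2) = G x z ->
  F (inord 0) (inord 3) = G x t -> F (inord 1) (inord 2) = G y z ->
  F (inord 1) (inord 3) = G y t -> F (inord 2) (inord 3) = G z t ->
  four x y z t \in emb G F.
Proof.
move=> [irr sym] [irrF symF] u e01 e02 e03 e12 e13 e23.
apply/embP; split; first exact: four_injective.
have f0 : four x y z t (inord 0) = x by rewrite ffunE (tnth_nth x) inordK.
have f1 : four x y z t (inord 1) = y by rewrite ffunE (tnth_nth x) inordK.
have f2 : four x y z t (inord 2) = z by rewrite ffunE (tnth_nth x) inordK.
have f3 : four x y z t (inord 3) = t by rewrite ffunE (tnth_nth x) inordK.
by do 2!apply: ord4P; rewrite ?f0 ?f1 ?f2 ?f3 ?irr ?irrF // symF sym.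
Qed.

Lemma K4_simple : simple_graph K4.
Proof. by split=> [i|i j]; rewrite /K4 ?eqxx // eq_sym. Qed.

Lemma twoK2_simple : simple_graph twoK2.
Proof. by split=> [i|i j]; rewrite /twoK2 ?eqxx // eq_sym [_./2 == _]eq_sym. Qed.

Lemma K4E i j : i < 4 -> j < 4 -> K4 (inord i) (inord j) = (i != j).
Proof. by move=> i4 j4; rewrite /K4 -(inj_eq val_inj) /= !inordK. Qed.

Lemma twoK2E i j : i < 4 -> j < 4 ->
  twoK2 (inord i) (inord j) = (i != j) && (i./2 == j./2).
Proof. by move=> i4 j4; rewrite /twoK2 -(inj_eq val_inj) /= !inordK. Qed.

(** In an induced [2 K2] both edges would have an end in the triangle [a b c], and these two ends
    would be adjacent. *)
Lemma K4_pendants_emb (H : rel 'I_7) : simple_graph H ->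
  3 <= #|[set v | degree H v == 1]| -> 3 <= #|[set v | degree H v == 4]| ->
  [/\ exists f, f \in emb H K4, ~ (exists f, f \in emb H twoK2)
    & 0 < #|[set v | degree H v == 3]|].
Proof.
move=> sH h1 h4; have [irr sym] := sH.
have [a [b [c [w [[ab ac bc aw bw] cw dw edge]]]]] := K4_pendants sH h1 h4.
have neq u v : H u v -> u != v by apply: contraTneq => ->; rewrite irr.
split.
- exists (four a b c w); apply: emb_four; rewrite ?K4E ?ab ?ac ?aw ?bc ?bw ?cw //.
    exact: K4_simple.
  by rewrite /= !inE !negb_or !neq.
- case=> f /embP[injf FE].
  have adj u v : u \in [:: a; b; c] -> v \in [:: a; b; c] -> u != v -> H u v.
    by rewrite !inE => /or3P[]/eqP-> /or3P[]/eqP->; rewrite ?eqxx // => _; rewrite // sym.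
  have e01 : H (f (inord 0)) (f (inord 1)) by rewrite -FE twoK2E.
  have e23 : H (f (inord 2)) (f (inord 3)) by rewrite -FE twoK2E.
  have no i j : i < 2 -> 2 <= j < 4 -> f (inord i) \in [:: a; b; c] ->
      f (inord j) \in [:: a; b; c] -> False.
    case: i j => [|[|i]] [|[|[|[|j]]]] // _ _ fi fj;
      by have := adj _ _ fi fj; rewrite (inj_eq injf) -FE twoK2E //
        -(inj_eq val_inj) /= !inordK //= => /(_ isT).
  by have /orP[] := edge _ _ e01; have /orP[] := edge _ _ e23 => p q; apply: no q p.
- by apply/card_gt0P; exists w; rewrite inE dw.
Qed.

(** At least three vertices of the [K4] have degree 3, hence no neighbour outside it. A vertex of
    degree 2 lies outside and has a neighbour other than the possible exception [f i0]; that edge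
    and an edge between two closed vertices form [2 K2]. *)
Lemma K4_twoK2 n (G : rel 'I_n) : simple_graph G ->
  #|[set v | 3 < degree G v]| <= 1 -> 0 < #|[set v | degree G v == 2]| ->
  (exists f, f \in emb G K4) -> exists f, f \in emb G twoK2.
Proof.
move=> sG big1 /card_gt0P[x]; rewrite inE => /eqP dx [f /embP[injf FE]].
have [irr sym] := sG.
have subN i : f @: [set~ i] \subset [set u | G (f i) u].
  by apply/subsetP=> _ /imsetP[j jN ->]; move: jN; rewrite !inE -FE /K4 eq_sym.
have card3 i : #|f @: [set~ i]| = 3 by rewrite card_imset // cardsC1 card_ord.
have deg3 i : 3 <= degree G (f i) by have := subset_leq_card (subN i); rewrite card3.
(* If no vertex of the [K4] has larger degree, any index can play the exception. *)
have [i0 di0] : exists i0, forall i, i != i0 -> degree G (f i) = 3.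
  case: (pickP (fun i => 3 < degree G (f i))) => [i0 i0P|none]; last first.
    by exists ord0 => i _; apply/eqP; rewrite eqn_leq deg3 leqNgt none.
  exists i0 => i ne; apply/eqP; rewrite eqn_leq deg3 andbT leqNgt; apply/negP=> iP.
  have : [set f i; f i0] \subset [set v | 3 < degree G v].
    by apply/subsetP=> v; rewrite !inE => /orP[]/eqP->.
  by move/subset_leq_card; rewrite cards2 (inj_eq injf) ne => /leq_trans/(_ big1).
have nbr i u : i != i0 -> G (f i) u -> u \in codom f.
  move=> ne Gu; have : u \in f @: [set~ i].
    have /eqP -> : f @: [set~ i] == [set v | G (f i) v].
      by rewrite eqEcard subN card3 -/(degree G (f i)) di0.
    by rewrite inE.
  by case/imsetP=> j _ ->; apply: codom_f.
have xf : x \notin codom f.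
  by apply/negP=> /codomP[i xE]; have := deg3 i; rewrite -xE dx.
have [y Gxy y0] : exists2 y, G x y & y != f i0.
  have : 0 < #|[set u | G x u] :\ f i0|.
    by have := cardsD1 (f i0) [set u | G x u]; rewrite -/(degree G x) dx; case: (_ \in _); lia.
  by case/card_gt0P=> y; rewrite !inE => /andP[]; exists y.
(* Otherwise [y] would be a closed vertex of the [K4], and its neighbour [x] would lie in the [K4]
   too. *)
have yf : y \notin codom f.
  apply/negP=> /codomP[i yE]; have ne : i != i0 by rewrite -(inj_eq injf) -yE.
  by case/negP: xf; apply: nbr ne _; rewrite -yE sym.
have [i1 [i2 [n1 n2 n12]]] : exists i1 i2, [/\ i1 != i0, i2 != i0 & i1 != i2].
  have : 1 < #|[set~ i0]| by rewrite cardsC1 card_ord.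
  by case/card_gt1P=> i1 [i2 []]; rewrite !inE; exists i1, i2.
have nG i u : i != i0 -> u \notin codom f -> G u (f i) = false.
  by move=> ne uf; apply: contraNF uf; rewrite sym; apply: nbr.
exists (four x y (f i1) (f i2)); apply: emb_four => //.
- exact: twoK2_simple.
- rewrite /= !inE !negb_or (inj_eq injf) n12 /= !andbT.
  have out u i : u \notin codom f -> u != f i by apply: contraNneq => ->; apply: codom_f.
  by rewrite !out // !andbT; move: Gxy; apply: contraTneq => ->; rewrite irr.
all: by rewrite twoK2E //= ?Gxy ?(nG _ x) ?(nG _ y) // -FE /K4 n12.
Qed.

(** The coefficients of [(1 + X) (1 - X)^4] are 1, -3, 2, 2, -3, 1, so [H] has three vertices of
    degree 1 and three of degree 4. Its [K4] passes to [G], and the [2 K2] that this yields passes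
    back to [H], which has none. *)
Lemma no_altpoly10 (G H : rel 'I_7) : simple_graph G -> simple_graph H -> same_emb 4 G H ->
  ~ (forall i, i < 7 -> ((degree_count G i)%:R - (degree_count H i)%:R = altpoly 1 0 4 i)%R).
Proof.
move=> sG sH GH dE.
have [c1 c4] : 3 <= degree_count H 1 /\ 3 <= degree_count H 4.
  have := dE 1 isT; have := dE 4 isT.
  rewrite (_ : altpoly 1 0 4 1 = -3)%R // (_ : altpoly 1 0 4 4 = -3)%R //.
  by split; lia.
have [hK4 no2K2 c3] := K4_pendants_emb sH c1 c4.
apply: no2K2; apply: (same_emb_ex GH); apply: K4_twoK2 => //.
- have := sum_coef_degpoly (proj1 sG); rewrite !big_ord_recl big_ord0 /= /bump /= !add1n !coef_degpoly.
  have := dE 0 isT; have := dE 2 isT; have := dE 3 isT.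
  rewrite (_ : altpoly 1 0 4 0 = 1)%R // (_ : altpoly 1 0 4 2 = 2)%R //.
  rewrite (_ : altpoly 1 0 4 3 = 2)%R // => e3 e2 e0 eS.
  (* Among the 7 vertices of [G], at least 1, 2 and 3 have degree 0, 2 and 3; the last count uses
     the vertex of degree 3 in [H]. *)
  apply: (@leq_trans (degree_count G 4 + degree_count G 5 + degree_count G 6)); last first.
    by move: c3 e0 e2 e3 eS; rewrite -/(degree_count H 3); lia.
  have sub : [set v | 3 < degree G v] \subset
      [set v | degree G v == 4] :|: [set v | degree G v == 5] :|: [set v | degree G v == 6].
    apply/subsetP=> v; rewrite !inE; have := degree_lt v (proj1 sG); lia.
  apply: leq_trans (subset_leq_card sub) (leq_trans (leq_card_setU _ _) _).
  by rewrite leq_add2r leq_card_setU.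
- have := dE 2 isT; rewrite (_ : altpoly 1 0 4 2 = 2)%R // -/(degree_count G 2); lia.
- by apply: same_emb_ex hK4 => F; rewrite GH.
Qed.

(** Complementation sends degree [i] to [6 - i], which reverses the coefficients and exchanges [a]
    and [b]. *)
Lemma no_altpoly01 (G H : rel 'I_7) : simple_graph G -> simple_graph H -> same_emb 4 G H ->
  ~ (forall i, i < 7 -> ((degree_count G i)%:R - (degree_count H i)%:R = altpoly 0 1 4 i)%R).
Proof.
move=> sG sH GH dE.
apply: (no_altpoly10 (compl_simple sG) (compl_simple sH) (same_emb_compl GH)) => i i7.
have cE (K : rel 'I_7) : simple_graph K -> degree_count (compl K) i = degree_count K (6 - i).
  move=> [irr _]; apply: eq_card => v; rewrite !inE degree_compl //=.
  by have := degree_lt v irr; lia.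
rewrite !cE // dE; last by lia.
by move: i7; case: i {cE} => [|[|[|[|[|[|[|]]]]]]].
Qed.

Lemma no_isolated_and_dominating (G : rel 'I_7) : simple_graph G ->
  0 < degree_count G 0 -> 0 < degree_count G 6 -> False.
Proof.
move=> [irr sym] /card_gt0P[u]; rewrite inE => /eqP du /card_gt0P[v]; rewrite inE => /eqP dv.
have uv : G v u = false.
  rewrite sym; move/eqP: du; rewrite cards_eq0 => /eqP/setP/(_ v).
  by rewrite !inE.
have uNv : u != v by apply/eqP=> e; rewrite e dv in du.
have sub : [set w | G v w] \subset ~: [set u; v].
  apply/subsetP=> w; rewrite !inE negb_or => vw.
  by apply/andP; split; apply: contraTneq vw => ->; rewrite ?irr ?uv.
have := cardsC [set u; v]; rewrite cards2 uNv card_ord => /eqP.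
by have := subset_leq_card sub; rewrite -/(degree G v) dv; case: #|_| => [|[|[|[|[|[|?]]]]]].
Qed.

Lemma same_degrees7 (G H : rel 'I_7) : simple_graph G -> simple_graph H -> same_emb 4 G H ->
  same_degree_list G H.
Proof.
move=> sG sH GH; have [iG _] := sG; have [iH _] := sH.
have HG : same_emb 4 H G by move=> F; rewrite GH.
have [//|a [b dE]] := degpoly_diff _ iG iH GH.
have dE' i : ((degree_count G i)%:R - (degree_count H i)%:R = altpoly a b 4 i)%R.
  by rewrite -[RHS]dE coefB !coef_degpoly.
(* Swapping the graphs negates [(a, b)], so only the positive signs need refuting. *)
have dN i : ((degree_count H i)%:R - (degree_count G i)%:R = altpoly (- a) (- b) 4 i)%R.
  have -> : altpoly (- a) (- b) 4 i = (- altpoly a b 4 i)%R.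
    by rewrite /altpoly; case: i => [|[|i]]; ring.
  by rewrite -dE' opprB.
have := l1_degpoly iG iH; rewrite (eq_bigr (fun i : 'I_7 => `|altpoly a b 4 i|)%R); last first.
  by move=> i _; rewrite dE.
case/altpoly7 => -[ha hb].
- apply: degpoly_inj; apply/eqP; rewrite -subr_eq0; apply/eqP/polyP=> i.
  by rewrite dE ha hb coef0 /altpoly; case: i => [|[|i]]; ring.
- exfalso; have [a1|a1] : (a = 1 \/ - a = 1)%R by lia.
  + by apply: (no_altpoly10 sG sH GH) => i _; rewrite dE' a1 hb.
  + by apply: (no_altpoly10 sH sG HG) => i _; rewrite dN a1 hb oppr0.
- exfalso; have [b1|b1] : (b = 1 \/ - b = 1)%R by lia.
  + by apply: (no_altpoly01 sG sH GH) => i _; rewrite dE' b1 ha.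
  + by apply: (no_altpoly01 sH sG HG) => i _; rewrite dN b1 ha oppr0.
- exfalso; have [a1|a1] : (a = 1 \/ - a = 1)%R by lia.
  + have := dE' 0; have := dE' 6; rewrite hb a1.
    rewrite (_ : altpoly 1 1 4 0 = 1)%R // (_ : altpoly 1 1 4 6 = 1)%R // => e6 e0.
    by apply: (no_isolated_and_dominating sG); lia.
  + have := dN 0; have := dN 6; rewrite hb a1.
    rewrite (_ : altpoly 1 1 4 0 = 1)%R // (_ : altpoly 1 1 4 6 = 1)%R // => e6 e0.
    by apply: (no_isolated_and_dominating sH); lia.
Qed.

Lemma same_degrees_ge8 m (G H : rel 'I_m.+3) : 5 <= m -> simple_graph G -> simple_graph H ->
  same_emb m G H -> same_degree_list G H.
Proof.
move=> m5 [iG _] [iH _] GH; have m3 : m.+3 - 3 = m by lia.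
have m7 : 6 < m.+3 by lia.
have GH3 : same_emb (m.+3 - 3) G H by rewrite m3.
have [a [b dE]] := degpoly_diff m7 iG iH GH3; rewrite m3 in dE.
have l1 : (\sum_(i < m.+3) `|altpoly a b m i| <= (2 * m.+3)%:R)%R.
  by apply: le_trans (l1_degpoly iG iH); apply: ler_sum => i _; rewrite dE.
have [a0 b0] : (a = 0 /\ b = 0)%R.
  have [m8|m9] := leqP m 8; last exact: altpoly_ge12 l1.
  by apply: altpoly8_11 l1; rewrite m5.
apply: degpoly_inj; apply/eqP; rewrite -subr_eq0; apply/eqP/polyP=> i.
by rewrite dE a0 b0 coef0 /altpoly; case: i => [|[|i]]; ring.
Qed.

(** * Six vertices *)

Definition edge_rel n (s : seq (nat * nat)) : rel 'I_n :=
  fun i j => ((i : nat, j : nat) \in s) || ((j : nat, i : nat) \in s).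

(** Vertex 5 stays isolated when this is read on six vertices. *)
Definition cycle5 : seq (nat * nat) := [:: (0, 1); (1, 2); (2, 3); (3, 4); (4, 0)].
(** The centre is 0, with legs 1, then 2-3, then 4-5. *)
Definition spider : seq (nat * nat) := [:: (0, 1); (0, 2); (2, 3); (0, 4); (4, 5)].

Definition triples (n : nat) :=
  [seq (x, yz) | x <- iota 0 n, yz <- [seq (y, z) | y <- iota 0 n, z <- iota 0 n]].

(** Lists of naturals let the embeddings be counted by evaluation; [p], [q], [r] are the three
    adjacencies that determine a simple graph on three vertices. *)
Definition triple_filter (s : seq (nat * nat)) (p q r : bool) :=
  let e i j := ((i, j) \in s) || ((j, i) \in s) in
  [seq t <- triples 6 | [&& t.1 != t.2.1, t.1 != t.2.2, t.2.1 != t.2.2,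
     e t.1 t.2.1 == p, e t.1 t.2.2 == q & e t.2.1 t.2.2 == r]].

Lemma size_triple_filter p q r :
  size (triple_filter cycle5 p q r) = size (triple_filter spider p q r).
Proof. by case: p; case: q; case: r; vm_compute. Qed.

Lemma ord3P (P : 'I_3 -> Prop) : P (inord 0) -> P (inord 1) -> P (inord 2) -> forall i, P i.
Proof. by move=> P0 P1 P2 i; rewrite -(inord_val i); case: i => -[|[|[|m]]]. Qed.

Lemma mem_triples n (t : nat * (nat * nat)) :
  (t \in triples n) = [&& t.1 < n, t.2.1 < n & t.2.2 < n].
Proof.
case: t => x [y z]; apply/allpairsP/and3P => /= [[[u [v w]] /= [u6 vw6 [-> -> ->]]]|[x6 y6 z6]].
  move: u6 vw6; rewrite mem_iota => u6 /allpairsP[[v' w'] /= [v6 w6 [-> ->]]].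
  by move: v6 w6; rewrite !mem_iota.
exists (x, (y, z)); rewrite mem_iota; split=> //.
by apply/allpairsP; exists (y, z); rewrite !mem_iota.
Qed.

(** An embedding is recorded as its triple of values; symmetry and irreflexivity reduce the nine
    pattern conditions to three. *)
Lemma card_emb3 s (F : rel 'I_3) : simple_graph F -> irreflexive (@edge_rel 6 s) ->
  #|emb (@edge_rel 6 s) F| =
  size (triple_filter s (F (inord 0) (inord 1)) (F (inord 0) (inord 2)) (F (inord 1) (inord 2))).
Proof.
move=> [irrF symF] irr; set G := @edge_rel 6 s.
have symG : symmetric G by move=> i j; rewrite /G /edge_rel orbC.
pose c (f : {ffun 'I_3 -> 'I_6}) : nat * (nat * nat) :=
  (val (f (inord 0)), (val (f (inord 1)), val (f (inord 2)))).
have injc : injective c.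
  move=> f g [/val_inj e0 /val_inj e1 /val_inj e2]; apply/ffunP.
  exact: ord3P.
rewrite cardE -(size_map c); apply: perm_size; apply: uniq_perm.
- by rewrite map_inj_uniq ?enum_uniq.
- by rewrite filter_uniq.
move=> [x [y z]]; rewrite mem_filter mem_triples /=.
have F3 (f : {ffun 'I_3 -> 'I_6}) : (f \in emb G F) =
   [&& val (f (inord 0)) != val (f (inord 1)), val (f (inord 0)) != val (f (inord 2)),
       val (f (inord 1)) != val (f (inord 2)), G (f (inord 0)) (f (inord 1)) == F (inord 0) (inord 1),
       G (f (inord 0)) (f (inord 2)) == F (inord 0) (inord 2)
     & G (f (inord 1)) (f (inord 2)) == F (inord 1) (inord 2)].
  rewrite !(inj_eq val_inj).
  have ne i j : i < 3 -> j < 3 -> (inord i == inord j :> 'I_3) = (i == j).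
    by move=> i3 j3; rewrite -(inj_eq val_inj) /= !inordK.
  apply/embP/and5P => [[injf FE]|[n01 n02 n12 /eqP e01 /andP[/eqP e02 /eqP e12]]].
    by rewrite !(inj_eq injf) !ne // !FE !eqxx.
  split; last by do 2!apply: ord3P; rewrite ?irrF ?irr // -?e01 -?e02 -?e12 // symF -?e01 -?e02 -?e12 symG.
  apply: ord3P; apply: ord3P => // e; move: n01 n02 n12; rewrite ?e ?eqxx //.
apply/mapP/andP => [[f]|[cond /and3P[x6 y6 z6]]].
  by rewrite mem_enum F3 => fE [-> -> ->]; rewrite !ltn_ord.
exists [ffun i : 'I_3 => tnth [tuple Ordinal x6; Ordinal y6; Ordinal z6] i].
  by rewrite mem_enum F3 !ffunE !(tnth_nth (Ordinal x6)) !inordK.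
by rewrite /c !ffunE !(tnth_nth (Ordinal x6)) !inordK.
Qed.

Lemma edge_rel_simple n (s : seq (nat * nat)) : all (fun e => e.1 != e.2) s ->
  simple_graph (@edge_rel n s).
Proof.
move=> /allP loop; split=> [i|i j]; last by rewrite /edge_rel orbC.
by rewrite /edge_rel orbb; apply/negP=> /loop /=; rewrite eqxx.
Qed.

Lemma degree_edge_rel n (s : seq (nat * nat)) (v : 'I_n) :
  degree (edge_rel s) v = count (fun u => ((val v, u) \in s) || ((u, val v) \in s)) (iota 0 n).
Proof.
rewrite -val_enum_ord count_map /degree cardsE cardE size_filter enumT; exact: eq_count.
Qed.

Lemma six_vertex_example : exists G H : rel 'I_6, [/\ simple_graph G, simple_graph H,
  same_deck 3 G H & ~~ same_degree_list G H].
Proof.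
have s1 : simple_graph (@edge_rel 6 cycle5) by apply: edge_rel_simple.
have s2 : simple_graph (@edge_rel 6 spider) by apply: edge_rel_simple.
exists (@edge_rel 6 cycle5), (@edge_rel 6 spider); split=> //.
  apply: same_emb_deck => F sF.
  rewrite (card_emb3 sF (proj1 s1)) (card_emb3 sF (proj1 s2)); exact: size_triple_filter.
pose deg (s : seq (nat * nat)) v := count (fun u => ((v, u) \in s) || ((u, v) \in s)) (iota 0 6).
have degs s : [seq degree (@edge_rel 6 s) v | v <- enum 'I_6] = [seq deg s v | v <- iota 0 6].
  transitivity [seq deg s v | v <- [seq val i | i <- enum 'I_6]]; last by rewrite val_enum_ord.
  by rewrite -[RHS]map_comp; apply: eq_map => v; apply: degree_edge_rel.
by rewrite /same_degree_list !degs; vm_compute.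
Qed.

Theorem theorem1p7 :
  (forall (n : nat), 7 <= n ->
     forall G H : rel 'I_n, simple_graph G -> simple_graph H ->
       same_deck (n - 3) G H -> same_degree_list G H)
  /\
  (exists G H : rel 'I_6, [/\ simple_graph G, simple_graph H,
       same_deck 3 G H & ~~ same_degree_list G H]).
Proof.
split; last exact: six_vertex_example.
case=> [|[|[|m]]] // m7 G H sG sH; rewrite !subSS subn0 => /(same_deck_emb sG sH) GH.
have [m5|m4] := leqP 5 m; first exact: same_degrees_ge8.
have mE : m = 4 by lia.
by move: G H sG sH GH; rewrite mE => G H sG sH GH; apply: same_degrees7.
Qed.
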